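(* Let $\alpha\in[0,\frac{\pi}{2})$ and let $A,B\in M_n$ with $A \in \prod_{1,\alpha}^n$. Then, for either choice of sign, \begin{equation*} w(AB \pm BA) \le 2\sqrt{1+\sin^2(\alpha)}\,\| B\|\,w(A). \end{equation*}
   Context: $M_n$ ($n\ge 1$) is the algebra of $n\times n$ complex matrices acting on $\mathbb{C}^n$ with operator norm $\|\cdot\|$. $W(A)=\{\langle Ax,x\rangle: x\in\mathbb{C}^n,\ \|x\|=1\}$ and $w(A)=\sup\{|z|:z\in W(A)\}$. For $\alpha\in[0,\frac{\pi}{2})$ let $S_\alpha=\{z\in\mathbb{C}:\Re z>0,\ |\Im z|\le\tan(\alpha)\,\Re z\}$. $\prod_{1,\alpha}^n$ denotes the set of $A\in M_n$ with $W(A)\subseteq S_\alpha$. *)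

(* Defs.v *)
From mathcomp Require Import all_boot all_order all_algebra.
From mathcomp Require Import complex.
From mathcomp Require Import boolp classical_sets reals trigo.

Set Implicit Arguments.
Unset Strict Implicit.
Unset Printing Implicit Defensive.

Import Order.TTheory GRing.Theory Num.Theory.

Local Open Scope classical_set_scope.
Local Open Scope ring_scope.
Local Open Scope sesquilinear_scope.

Section NumericalRange.
Context {R : realType}.
Local Notation C := (R[i]).

(* Linear in the first argument, conjugate-linear in the second. *)
Definition cdot n (x y : 'cV[C]_n) : C := (y^t* *m x) 0 0.

(* [cdot x x] is a nonnegative real, so taking [Re] loses nothing. *)
Definition cnorm n (x : 'cV[C]_n) : R := Num.sqrt (complex.Re (cdot x x)).

(* The suprema below are taken in [R], where [sup] is 0 on sets that are empty
   or unbounded above; for n >= 1 both sets are nonempty and bounded. *)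
Definition opnorm n (A : 'M[C]_n) : R :=
  sup [set cnorm (A *m x) | x in [set x : 'cV[C]_n | cnorm x = 1]].

Definition numrange n (A : 'M[C]_n) : set C :=
  [set cdot (A *m x) x | x in [set x : 'cV[C]_n | cnorm x = 1]].

(* [ComplexField.Normc.normc] is the modulus as an element of [R], whereas
   [`|z|] is the same number as an element of [R[i]]. *)
Definition numradius n (A : 'M[C]_n) : R :=
  sup [set ComplexField.Normc.normc z | z in numrange A].

Definition sector (alpha : R) : set C :=
  [set z | 0 < complex.Re z /\
           `|complex.Im z| <= tan alpha * complex.Re z].

Definition sectorial n (alpha : R) : set 'M[C]_n :=
  [set A | numrange A `<=` sector alpha].

End NumericalRange.

(* Main.v *)
Require Import Defs.
From mathcomp Require Import all_boot all_order all_algebra.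
From mathcomp Require Import complex.
From mathcomp Require Import boolp classical_sets reals trigo.
From mathcomp Require Import ring lra.
Import Order.TTheory GRing.Theory Num.Theory.
Local Open Scope ring_scope.
Local Open Scope sesquilinear_scope.

Import ComplexField.Normc.

(** For a unit vector x, the triangle inequality and Cauchy-Schwarz give
    |<(AB +- BA)x, x>| <= |<Bx, A* x>| + |<B(Ax), x>| <= |B| (|A* x| + |Ax|),
    which is [commutator_terms_le], so everything rests on the bound
    |Ax| + |A* x| <= 2 sqrt(1 + sin^2 alpha) w(A), which is
    [sectorial_cnormD_le].

    The sum of the two norms is at most sqrt 2 times the root of the sum of
    their squares, and by the parallelogram law
    2 (|Ax|^2 + |A* x|^2) = |(A + A* )x|^2 + |(A - A* )x|^2.
    The matrices A + A* and i(A - A* ) are Hermitian, and the operator norm of a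
    Hermitian matrix equals its numerical radius; [hermitian_cnorm_le] proves
    the inequality that is used, by polarization.  Their quadratic forms at x
    are twice the real part and minus twice the imaginary part of <Ax, x>.
    The first form is bounded by 2 w(A).  The sector condition says that the
    argument of <Ax, x> is at most alpha in absolute value, hence
    |Im <Ax, x>| <= sin alpha |<Ax, x>| ([sector_Im_le]), so the second form is
    bounded by 2 sin alpha w(A).  Adding the squares of these two bounds gives
    4 (1 + sin^2 alpha) w(A)^2. *)

(** * The Hermitian product and its norm *)

Section InnerProduct.
Context {R : realType}.
Local Notation C := (R[i]).
Local Notation re := (@complex.Re R).
Local Notation im := (@complex.Im R).
Implicit Types (n : nat) (z : C).

Lemma ler_sqr_ge0 (a b : R) : 0 <= a -> a <= b -> a ^+ 2 <= b ^+ 2.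
Proof. by move=> a0 ab; rewrite ler_sqr ?nnegrE ?(le_trans a0). Qed.

Lemma normc_conj z : normc (Num.conj z) = normc z.
Proof. by apply: complexI; exact: normcJ. Qed.

Lemma normc_ge0 z : 0 <= normc z.
Proof. by case: z => a b; exact: sqrtr_ge0. Qed.

Lemma sqr_normc_ReIm z : normc z ^+ 2 = re z ^+ 2 + im z ^+ 2.
Proof. by case: z => a b; rewrite sqr_sqrtr // addr_ge0 ?sqr_ge0. Qed.

Lemma ReB z w : re (z - w) = re z - re w.
Proof. by case: z w => a b []. Qed.

Lemma Re_le_normc z : `|re z| <= normc z.
Proof. by rewrite -lecR; exact: normc_ge_Re. Qed.

Lemma normc_real (r : R) : normc (r%:C)%C = `|r|.
Proof. by rewrite /= expr0n addr0 sqrtr_sqr. Qed.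

Lemma normc_i : normc ('i%C : C) = 1.
Proof. by rewrite /= expr0n expr1n add0r sqrtr1. Qed.

Lemma subC_conj z : z - Num.conj z = ((2 * im z)%:C * 'i)%C.
Proof.
case: z => a b; have -> : Num.conj (a +i* b)%C = (a -i* b)%C by [].
by apply/eqP; rewrite eq_complex /=; apply/andP; split; apply/eqP; ring.
Qed.

Lemma conj_real (r : R) : Num.conj (r%:C)%C = (r%:C)%C.
Proof. exact: conjc_real. Qed.

Lemma conj_realM (r : R) z : Num.conj ((r%:C)%C * z) = (r%:C)%C * Num.conj z.
Proof. by rewrite rmorphM; congr (_ * _); exact: conj_real. Qed.

Lemma cdotE n (x y : 'cV[C]_n) :
  cdot x y = \sum_i x i 0 * Num.conj (y i 0).
Proof. by rewrite /cdot mxE; apply: eq_bigr => i _; rewrite !mxE mulrC. Qed.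

(** Transfers sesquilinearity and Cauchy-Schwarz from the row-vector dot
    product to [cdot]. *)
Lemma cdot_dotmx n (x y : 'cV[C]_n) : cdot x y = dotmx x^T y^T.
Proof. by rewrite cdotE dotmxE mxE; apply: eq_bigr => i _; rewrite !mxE. Qed.

Lemma cdotDl n (x y z : 'cV[C]_n) : cdot (x + y) z = cdot x z + cdot y z.
Proof. by rewrite !cdot_dotmx linearD linearDl. Qed.

Lemma cdotZl n a (x z : 'cV[C]_n) : cdot (a *: x) z = a * cdot x z.
Proof. by rewrite !cdot_dotmx linearZ linearZl_LR. Qed.

Lemma cdotDr n (x y z : 'cV[C]_n) : cdot z (x + y) = cdot z x + cdot z y.
Proof. by rewrite !cdot_dotmx linearD linearDr. Qed.

Lemma cdotZr n a (x z : 'cV[C]_n) : cdot z (a *: x) = Num.conj a * cdot z x.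
Proof. by rewrite !cdot_dotmx linearZ linearZr_LR. Qed.

Lemma cdotC n (x y : 'cV[C]_n) : cdot x y = Num.conj (cdot y x).
Proof.
rewrite !cdotE rmorph_sum; apply: eq_bigr => i _.
by rewrite rmorphM /= conjCK mulrC.
Qed.

Lemma cdot_adj n (A : 'M[C]_n) (x y : 'cV[C]_n) :
  cdot (A *m x) y = cdot x (A^t* *m y).
Proof. by rewrite /cdot trmx_mul map_mxM trmxCK mulmxA. Qed.

Lemma cdot_cnorm n (x : 'cV[C]_n) : cdot x x = ((cnorm x ^+ 2)%:C)%C.
Proof.
have h : 0 <= cdot x x.
  by rewrite cdotE; apply: sumr_ge0 => i _; exact: mul_conjC_ge0.
rewrite /cnorm sqr_sqrtr; last by move: h; rewrite lecE => /andP[].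
by rewrite RRe_real // ger0_real.
Qed.

Lemma cnorm_ge0 n (x : 'cV[C]_n) : 0 <= cnorm x.
Proof. exact: sqrtr_ge0. Qed.

Lemma cnorm_sum n (x : 'cV[C]_n) :
  cnorm x ^+ 2 = \sum_i normc (x i 0) ^+ 2.
Proof.
apply: complexI; rewrite -cdot_cnorm cdotE rmorph_sum.
by apply: eq_bigr => i _; rewrite rmorphXn /= -normCK.
Qed.

Lemma cnorm0_eq0 n (x : 'cV[C]_n) : cnorm x = 0 -> x = 0.
Proof.
move=> h; apply/colP => i; rewrite mxE; apply: eq0_normc; apply/eqP.
rewrite -sqrf_eq0; move: (cnorm_sum _ x); rewrite h expr0n /= => /esym/eqP.
by rewrite psumr_eq0 => [/allP/(_ i (mem_index_enum _))|j _]; rewrite ?sqr_ge0.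
Qed.

Lemma cnormZ n a (x : 'cV[C]_n) : cnorm (a *: x) = normc a * cnorm x.
Proof.
apply/eqP; rewrite -(@eqrXn2 _ 2) // ?mulr_ge0 ?normc_ge0 ?cnorm_ge0 //.
rewrite exprMn !cnorm_sum mulr_sumr; apply/eqP/eq_bigr => i _.
by rewrite mxE normcM exprMn.
Qed.

Lemma normc_cdot_le n (x y : 'cV[C]_n) :
  normc (cdot x y) <= cnorm x * cnorm y.
Proof.
rewrite -(@ler_pXn2r _ 2) ?nnegrE ?mulr_ge0 ?normc_ge0 ?cnorm_ge0 //.
rewrite -lecR exprMn (rmorphM _ (cnorm x ^+ 2)).
rewrite /= -!cdot_cnorm rmorphXn /= !cdot_dotmx.
exact: CauchySchwarz.
Qed.

Lemma cnorm_parallelogram n (x y : 'cV[C]_n) :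
  cnorm (x + y) ^+ 2 + cnorm (x - y) ^+ 2 = 2 * (cnorm x ^+ 2 + cnorm y ^+ 2).
Proof.
rewrite (cnorm_sum _ (x + y)) (cnorm_sum _ (x - y)) (cnorm_sum _ x) (cnorm_sum _ y).
rewrite -!big_split mulr_sumr /=; apply: eq_bigr => i _.
by rewrite !mxE !sqr_normc_ReIm; case: (x i 0) (y i 0) => a b [c d] /=; ring.
Qed.

(** Reduces statements about all vectors to unit vectors.  The dimension has to
    be positive so that the zero vector, too, has a direction. *)
Lemma polar n (hn : (0 < n)%N) (x : 'cV[C]_n) :
  exists2 u : 'cV[C]_n, cnorm u = 1 & x = ((cnorm x)%:C)%C *: u.
Proof.
have [x0|x0] := eqVneq (cnorm x) 0.
  exists (delta_mx (Ordinal hn) 0); last by rewrite x0 scale0r; exact: cnorm0_eq0.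
  apply/eqP; rewrite -(@eqrXn2 _ 2) ?cnorm_ge0 // cnorm_sum expr1n.
  rewrite (bigD1 (Ordinal hn)) //= big1 => [|i /negPf ni].
    by rewrite mxE !eqxx normc1 expr1n addr0.
  by rewrite mxE ni normc0 expr0n.
exists ((((cnorm x)^-1)%:C)%C *: x).
  by rewrite cnormZ normc_real ger0_norm ?invr_ge0 ?cnorm_ge0 // mulVf.
by rewrite scalerA -rmorphM mulfV // scale1r.
Qed.

(** * Operator norm and numerical radius as bounds on vectors *)

(** The i-th entry of Bx is the product of x with the adjoint of row i of B, so
    Cauchy-Schwarz row by row bounds |Bx| by the Frobenius norm of B. *)
Lemma opnorm_has_ubound n (B : 'M[C]_n) :
  has_ubound [set cnorm (B *m x) | x in [set x : 'cV[C]_n | cnorm x = 1]]%classic.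
Proof.
exists (Num.sqrt (\sum_i cnorm ((row i B)^t*) ^+ 2)) => _ [x /= x1 <-].
have F0 : 0 <= \sum_i cnorm ((row i B)^t*) ^+ 2.
  by apply: sumr_ge0 => i _; exact: sqr_ge0.
rewrite -(@ler_pXn2r _ 2) ?nnegrE ?cnorm_ge0 ?sqrtr_ge0 //.
rewrite (sqr_sqrtr F0) (cnorm_sum _ (B *m x)).
apply: ler_sum => i _.
rewrite ler_pXn2r ?nnegrE ?normc_ge0 ?cnorm_ge0 //.
have -> : (B *m x) i 0 = cdot x ((row i B)^t*).
  by rewrite /cdot trmxCK -row_mul [RHS]mxE.
by apply: le_trans (normc_cdot_le _ _ _) _; rewrite x1 mul1r.
Qed.

Lemma cnorm_mul_le n (hn : (0 < n)%N) (B : 'M[C]_n) (x : 'cV[C]_n) :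
  cnorm (B *m x) <= opnorm B * cnorm x.
Proof.
have [u u1 ->] := polar _ hn x.
rewrite -scalemxAr !cnormZ u1 mulr1 mulrC ler_wpM2r ?normc_ge0 //.
by apply: ub_le_sup (opnorm_has_ubound _ B) _ _; exists u.
Qed.

Lemma opnorm_ge0 n (hn : (0 < n)%N) (B : 'M[C]_n) : 0 <= opnorm B.
Proof.
have [u u1 _] := polar _ hn 0; apply: le_trans (cnorm_ge0 _ (B *m u)) _.
by rewrite -[leRHS]mulr1 -u1; exact: cnorm_mul_le.
Qed.

Lemma normc_le_numradius n (hn : (0 < n)%N) (A : 'M[C]_n) z :
  numrange A z -> normc z <= numradius A.
Proof.
move=> Az; apply: ub_le_sup; last by exists z.
exists (opnorm A) => _ [_ [x /= x1 <-] <-].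
apply: le_trans (normc_cdot_le _ _ _) _; rewrite x1 mulr1.
by rewrite -[leRHS]mulr1 -x1 cnorm_mul_le.
Qed.

Lemma numradius_ge0 n (hn : (0 < n)%N) (A : 'M[C]_n) : 0 <= numradius A.
Proof.
have [u u1 _] := polar _ hn 0; apply: le_trans (normc_ge0 (cdot (A *m u) u)) _.
by apply: normc_le_numradius => //; exists u.
Qed.

Lemma numradius_le n (hn : (0 < n)%N) (A : 'M[C]_n) (c : R) :
  (forall x, cnorm x = 1 -> normc (cdot (A *m x) x) <= c) -> numradius A <= c.
Proof.
move=> h; apply: ge_sup; last by move=> _ [_ [x /= x1 <-] <-]; exact: h.
have [u u1 _] := polar _ hn 0.
by exists (normc (cdot (A *m u) u)), (cdot (A *m u) u) => //; exists u.
Qed.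

Lemma cdot_numrange n (hn : (0 < n)%N) (A : 'M[C]_n) (x : 'cV[C]_n) :
  exists2 z, numrange A z & cdot (A *m x) x = ((cnorm x ^+ 2)%:C)%C * z.
Proof.
have [u u1 ->] := polar _ hn x; exists (cdot (A *m u) u); first by exists u.
rewrite -scalemxAr cdotZl cdotZr cnormZ u1 mulr1 normc_real.
rewrite real_normK ?num_real // rmorphXn /= expr2 mulrA.
by rewrite conj_real.
Qed.

(** * Hermitian and skew parts of a sectorial matrix *)

(** Apply the bound on the quadratic form at x + y and x - y, where y = t Hx with
    t real.  As H is Hermitian, the two values differ by 4 t |Hx|^2, while the
    parallelogram law bounds the difference by 2 c (|x|^2 + t^2 |Hx|^2).  The
    resulting inequality [key] holds for all t. *)
Lemma hermitian_cnorm_le n (H : 'M[C]_n) (c : R) :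
  H^t* = H -> 0 <= c ->
  (forall x, normc (cdot (H *m x) x) <= c * cnorm x ^+ 2) ->
  forall x, cnorm (H *m x) <= c * cnorm x.
Proof.
move=> Hh c0 hH x; set s := cnorm (H *m x).
have key (t : R) : 2 * t * s ^+ 2 <= c * (cnorm x ^+ 2 + t ^+ 2 * s ^+ 2).
  have [y [ny e1 e2]] : exists y : 'cV[C]_n, [/\ cnorm y ^+ 2 = t ^+ 2 * s ^+ 2,
      cdot (H *m x) y = ((t * s ^+ 2)%:C)%C &
      cdot (H *m y) x = ((t * s ^+ 2)%:C)%C].
    exists ((t%:C)%C *: (H *m x)); split.
    - by rewrite cnormZ normc_real exprMn real_normK ?num_real.
    - by rewrite cdotZr cdot_cnorm conj_real (rmorphM _ t).
    - by rewrite cdot_adj Hh cdotZl cdot_cnorm (rmorphM _ t).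
  have polarization : cdot (H *m (x + y)) (x + y) - cdot (H *m (x - y)) (x - y)
      = ((4 * t * s ^+ 2)%:C)%C.
    rewrite -(scaleN1r y) !mulmxDr -!scalemxAr.
    rewrite !(cdotDl, cdotDr, cdotZl, cdotZr).
    rewrite e1 e2 rmorphN rmorph1 !rmorphM /= rmorph_nat; ring.
  have hRe := congr1 re polarization; rewrite ReB [RHS]/= in hRe.
  have hp := le_trans (ler_norm _) (le_trans (Re_le_normc _) (hH (x + y))).
  have hm : - re (cdot (H *m (x - y)) (x - y)) <= c * cnorm (x - y) ^+ 2.
    apply: le_trans (hH (x - y)); apply: le_trans (Re_le_normc _).
    by rewrite -normrN ler_norm.
  have par := cnorm_parallelogram _ x y; rewrite ny in par.
  have combine (p q u v X S : R) : p - q = 4 * t * S -> p <= c * u ->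
      - q <= c * v -> u + v = 2 * (X + t ^+ 2 * S) ->
      2 * t * S <= c * (X + t ^+ 2 * S).
    clear; move=> e h1 h2 uv; have := mulrDr c u v; rewrite uv; lra.
  exact: combine hRe hp hm par.
rewrite -(@ler_pXn2r _ 2) ?nnegrE ?mulr_ge0 ?cnorm_ge0 // exprMn.
(* The best choice is t = 1 / c; for c = 0 any positive t forces Hx = 0. *)
have [c00|cn0] := eqVneq c 0.
  by have := key 1; rewrite c00; lra.
have cp : 0 < c by rewrite lt_def cn0.
have := ler_wpM2l c0 (key c^-1).
have -> : c * (2 * c^-1 * s ^+ 2) = 2 * s ^+ 2 by field.
have -> : c * (c * (cnorm x ^+ 2 + c^-1 ^+ 2 * s ^+ 2))
  = c ^+ 2 * cnorm x ^+ 2 + s ^+ 2 by field.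
by lra.
Qed.

Lemma sin_ge0_acute (alpha : R) : 0 <= alpha < pi / 2 -> 0 <= sin alpha.
Proof.
case/andP=> a0 a1; apply: sin_ge0_pi; rewrite a0 /=.
by have := pi_ge0 R; lra.
Qed.

(** Squaring cos alpha |Im z| <= sin alpha Re z and adding
    sin^2 alpha (Im z)^2 to both sides turns Re z into |z|. *)
Lemma sector_Im_le (alpha : R) z : 0 <= alpha < pi / 2 ->
  sector alpha z -> `|im z| <= sin alpha * normc z.
Proof.
move=> ha [z0 hz]; have sp := sin_ge0_acute _ ha.
have cp : 0 < cos alpha.
  by apply: cos_gt0_pihalf; case/andP: ha => a0 a1; apply/andP; split; lra.
rewrite -(@ler_pXn2r _ 2) ?nnegrE ?mulr_ge0 ?normc_ge0 ?normr_ge0 //.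
rewrite exprMn sqr_normc_ReIm real_normK ?num_real //.
have hc : cos alpha * `|im z| <= sin alpha * re z.
  rewrite -(ler_pM2l cp) in hz; apply: le_trans hz _; rewrite /tan.
  by rewrite mulrA [_ * (_ / _)]mulrC divfK ?gt_eqF.
have := ler_sqr_ge0 _ _ (mulr_ge0 (ltW cp) (normr_ge0 _)) hc.
rewrite !exprMn real_normK ?num_real //.
have -> : cos alpha ^+ 2 = 1 - sin alpha ^+ 2.
  by rewrite -(cos2Dsin2 alpha); ring.
by lra.
Qed.

Section Sectorial.
Context n (hn : (0 < n)%N) (A : 'M[C]_n).

(** The Hermitian matrix A + A* has quadratic form z + conj z, where
    z = <Ax, x>, and |z + conj z| <= 2 |z|. *)
Lemma hermitian_part_le x : cnorm (A *m x + A^t* *m x) <= 2 * numradius A * cnorm x.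
Proof.
rewrite -mulmxDl; apply: hermitian_cnorm_le.
- by rewrite linearD /= map_mxD trmxCK addrC.
- by rewrite mulr_ge0 ?numradius_ge0.
move=> {}x; rewrite mulmxDl cdotDl [cdot (_^t* *m _) _]cdot_adj trmxCK.
rewrite [cdot x _]cdotC; apply: le_trans (le_normcD _ _) _; rewrite normc_conj.
have [z Az ->] := cdot_numrange _ hn A x.
rewrite normcM normc_real ger0_norm ?sqr_ge0 //.
have := ler_wpM2l (sqr_ge0 (cnorm x)) (normc_le_numradius _ hn _ _ Az).
by lra.
Qed.

(** The place where the sector enters: A - A* has quadratic form 2i Im <Ax, x>,
    so the sine of the sector angle improves the bound 2 w(A).  Multiplying by
    i makes the matrix Hermitian without changing norms. *)
Lemma skew_part_le alpha x : 0 <= alpha < pi / 2 -> sectorial alpha A ->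
  cnorm (A *m x - A^t* *m x) <= 2 * (sin alpha * numradius A) * cnorm x.
Proof.
move=> ha hA.
have sp := sin_ge0_acute _ ha.
have -> : cnorm (A *m x - A^t* *m x) = cnorm (('i%C *: (A - A^t*)) *m x).
  rewrite -scalemxAl cnormZ mulmxBl -[LHS]mul1r; congr (_ * _).
  by rewrite normc_i.
apply: hermitian_cnorm_le.
- apply/matrixP => i j; rewrite !mxE !rmorphM !rmorphB /= conjCK.
  have -> : Num.conj ('i%C : C) = - 'i%C by rewrite complexiE conjCi.
  ring.
- by rewrite !mulr_ge0 ?numradius_ge0.
move=> {}x; rewrite -scalemxAl cdotZl normcM mulmxBl -scaleN1r cdotDl cdotZl.
rewrite [cdot (_^t* *m _) _]cdot_adj trmxCK [cdot x _]cdotC.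
have [z Az ->] := cdot_numrange _ hn A x.
rewrite conj_realM.
have -> : (cnorm x ^+ 2)%:C%C * z + -1 * ((cnorm x ^+ 2)%:C%C * Num.conj z)
  = (cnorm x ^+ 2)%:C%C * ((2 * im z)%:C%C * 'i%C).
  by rewrite -subC_conj; ring.
rewrite !normcM !normc_real.
rewrite normc_i mul1r mulr1 ger0_norm ?sqr_ge0 // normrM (ger0_norm (ler0n _ 2)).
have h1 := sector_Im_le _ _ ha (hA _ Az).
have h2 := ler_wpM2l sp (normc_le_numradius _ hn _ _ Az).
have := ler_wpM2l (sqr_ge0 (cnorm x)) (le_trans h1 h2).
by lra.
Qed.

(** Combines (a + b)^2 <= 2 (a^2 + b^2), the parallelogram law for Ax and A* x,
    and the bounds for the Hermitian and skew parts. *)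
Lemma sectorial_cnormD_le alpha x : 0 <= alpha < pi / 2 -> sectorial alpha A ->
  cnorm (A *m x) + cnorm (A^t* *m x)
    <= 2 * Num.sqrt (1 + sin alpha ^+ 2) * numradius A * cnorm x.
Proof.
move=> ha hA.
have w0 := numradius_ge0 _ hn A.
have s0 : 0 <= 1 + sin alpha ^+ 2 by rewrite addr_ge0 ?sqr_ge0.
rewrite -(@ler_pXn2r _ 2) ?nnegrE ?addr_ge0 ?mulr_ge0 ?cnorm_ge0 ?sqrtr_ge0 //.
rewrite !exprMn sqr_sqrtr //.
have := ler_sqr_ge0 _ _ (cnorm_ge0 _ _) (hermitian_part_le x).
have := ler_sqr_ge0 _ _ (cnorm_ge0 _ _) (skew_part_le alpha x ha hA).
have := cnorm_parallelogram _ (A *m x) (A^t* *m x).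
have := sqr_ge0 (cnorm (A *m x) - cnorm (A^t* *m x)).
rewrite !exprMn.
move: (cnorm (A *m x)) (cnorm (A^t* *m x)) (cnorm (_ + _)) (cnorm (_ - _)).
move: (numradius A) (sin alpha) (cnorm x); clear => w sn r a b p q.
by move=> ab pq hq hp; lra.
Qed.

(** Bounding the two terms of AB +- BA separately makes the sign irrelevant.  In
    the first term A moves to the other side as its adjoint, so that B acts
    directly on the unit vector; the second term needs no adjoint of B. *)
Lemma commutator_terms_le alpha (B : 'M[C]_n) x :
  0 <= alpha < pi / 2 -> sectorial alpha A -> cnorm x = 1 ->
  normc (cdot (A *m B *m x) x) + normc (cdot (B *m A *m x) x)
    <= 2 * Num.sqrt (1 + sin alpha ^+ 2) * opnorm B * numradius A.
Proof.
move=> ha hA x1; have b0 := opnorm_ge0 _ hn B.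
have h1 : normc (cdot (A *m B *m x) x) <= opnorm B * cnorm (A^t* *m x).
  rewrite -mulmxA cdot_adj; apply: le_trans (normc_cdot_le _ _ _) _.
  rewrite ler_wpM2r ?cnorm_ge0 //.
  by have := cnorm_mul_le _ hn B x; rewrite x1 mulr1.
have h2 : normc (cdot (B *m A *m x) x) <= opnorm B * cnorm (A *m x).
  rewrite -mulmxA; apply: le_trans (normc_cdot_le _ _ _) _.
  by rewrite x1 mulr1; exact: cnorm_mul_le.
apply: le_trans (lerD h1 h2) _; rewrite -mulrDr addrC.
rewrite [leRHS](_ : _ = opnorm B *
    (2 * Num.sqrt (1 + sin alpha ^+ 2) * numradius A * cnorm x)).
  exact: ler_wpM2l b0 _ _ (sectorial_cnormD_le alpha x ha hA).
by rewrite x1 mulr1 [RHS]mulrA (mulrC (opnorm B)).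
Qed.

End Sectorial.
End InnerProduct.

Theorem corollary4p7 (R : realType) (n : nat) (hn : (0 < n)%N)
    (alpha : R) (halpha : 0 <= alpha < pi / 2)
    (A B : 'M[R[i]]_n) (hA : sectorial alpha A) :
  numradius (A *m B + B *m A)
    <= 2 * Num.sqrt (1 + sin alpha ^+ 2) * opnorm B * numradius A
  /\
  numradius (A *m B - B *m A)
    <= 2 * Num.sqrt (1 + sin alpha ^+ 2) * opnorm B * numradius A.
Proof.
split; apply: numradius_le => // x x1;
  apply: le_trans (commutator_terms_le _ hn A alpha B x halpha hA x1).
  by rewrite mulmxDl cdotDl; exact: le_normcD.
rewrite mulmxBl -scaleN1r cdotDl cdotZl mulN1r.
by apply: le_trans (le_normcD _ _) _; rewrite normcN.
Qed.
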